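(* Let $a_1,\dots,a_4,p_1,\dots,p_4,x_1,\dots,x_4,q_1,\dots,q_4$ be nonzero complex numbers. Put $K:=a_1a_2a_3a_4$, $L:=(p_1p_2p_3p_4)^{1/2}$, $K_0:=x_1x_2x_3x_4$, $L_0:=(q_1q_2q_3q_4)^{1/2}$. For an integer $k\ge -1$ define $$E_k[\bar a;\bar p]:=\big(a_1(p_1p_3)^{k/2}-a_2a_4(p_2p_4)^{k/2}/a_3\big)\big(a_1(p_1p_4)^{k/2}-a_2a_3(p_2p_3)^{k/2}/a_4\big),$$ $$D_k[\bar x;\bar q]:=x_1x_2(q_1q_2)^{k/2}-x_3x_4(q_3q_4)^{k/2}.$$ Then for every integer $n\ge0$ (whenever no denominator vanishes) $$\sum_{k=0}^{n-1}\frac{E_{k-1}[\bar a;\bar p]}{(p_3p_4)^{(k-1)/2}}\frac{(a_1^2/p_1;p_1)_k(a_2^2/p_2;p_2)_k(x_1^2;q_1)_k}{(Kp_3/(La_3^2);L/p_3)_{k+1}(Kp_4/(La_4^2);L/p_4)_{k+1}(K_0/x_2^2;L_0/q_2)_k}$$ $$=1-\frac{(a_1^2/p_1;p_1)_n(a_2^2/p_2;p_2)_n(x_1^2;q_1)_n}{(Kp_3/(La_3^2);L/p_3)_n(Kp_4/(La_4^2);L/p_4)_n(K_0/x_2^2;L_0/q_2)_n}$$ $$-\frac{x_1}{x_2}\sum_{k=0}^{n-1}D_k[\bar x;\bar q]\Big(\frac{q_1}{q_2}\Big)^{k/2}\frac{(a_1^2/p_1;p_1)_{k+1}(a_2^2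/p_2;p_2)_{k+1}(x_1^2;q_1)_k}{(Kp_3/(La_3^2);L/p_3)_{k+1}(Kp_4/(La_4^2);L/p_4)_{k+1}(K_0/x_2^2;L_0/q_2)_{k+1}}.$$
   Context: For a complex number $z$, a nonzero complex base $p$ and an integer $k\ge0$, $(z;p)_k:=\prod_{j=0}^{k-1}(1-zp^j)$. Square roots $p_i^{1/2},q_i^{1/2}$ are fixed, and every half-integer power of a product or quotient of the $p_i$ (resp. $q_i$) is understood as the corresponding product of powers of these fixed roots, e.g. $(q_1/q_2)^{k/2}=(q_1^{1/2}/q_2^{1/2})^k$. *)

(* Defs.v *)
From mathcomp Require Import all_boot all_order all_algebra.

Set Implicit Arguments.
Unset Strict Implicit.
Unset Printing Implicit Defensive.

Import GRing.Theory.
Local Open Scope ring_scope.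

Definition qpoch (F : fieldType) (z p : F) (k : nat) : F :=
  \prod_(0 <= j < k) (1 - z * p ^+ j).

(* In Ek and Dk the parameters r_i, s_i are the fixed square roots
   p_i^(1/2), q_i^(1/2), so that e.g. (p_1 p_3)^(k/2) is (r1 * r3) ^ k.
   The index k is an integer because k = -1 is used. *)
Definition Ek (F : fieldType) (a1 a2 a3 a4 r1 r2 r3 r4 : F) (k : int) : F :=
  (a1 * (r1 * r3) ^ k - a2 * a4 * (r2 * r4) ^ k / a3) *
  (a1 * (r1 * r4) ^ k - a2 * a3 * (r2 * r3) ^ k / a4).

Definition Dk (F : fieldType) (x1 x2 x3 x4 s1 s2 s3 s4 : F) (k : int) : F :=
  x1 * x2 * (s1 * s2) ^ k - x3 * x4 * (s3 * s4) ^ k.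

(* Main.v *)
(* Write the summands of the boundary term as U_k V_k, with
     U_k = (a1^2/p1)_k (a2^2/p2)_k / ((K p3/(L a3^2))_k (K p4/(L a4^2))_k)
     V_k = (x1^2)_k / (K0/x2^2)_k.
   Both one-step differences factor: U_k - U_(k+1) produces E_(k-1) and
   V_k - V_(k+1) produces D_k.  The identity is then summation by parts,
     1 - U_n V_n = sum V_k (U_k - U_(k+1)) + sum U_(k+1) (V_k - V_(k+1)). *)
Require Import Defs.
From mathcomp Require Import all_boot all_order all_algebra.
From mathcomp Require Import reals complex.
From mathcomp Require Import ring.

Set Implicit Arguments.
Unset Strict Implicit.
Unset Printing Implicit Defensive.

Import GRing.Theory.
Local Open Scope ring_scope.

Lemma qpochS (F : fieldType) (z p : F) k :
  qpoch z p k.+1 = qpoch z p k * (1 - z * p ^+ k).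
Proof. by rewrite /qpoch big_nat_recr. Qed.

Lemma qpoch0 (F : fieldType) (z p : F) : qpoch z p 0 = 1.
Proof. by rewrite /qpoch big_nil. Qed.

Lemma exprz_pred (F : fieldType) (x : F) (k : nat) :
  x != 0 -> x ^ (k%:Z - 1) = x ^+ k / x.
Proof. by move=> x0; rewrite expfzDr // exprz_inv expr1z. Qed.

Lemma sumr_by_parts (A : pzRingType) (U V : nat -> A) n :
  \sum_(0 <= k < n) (U k - U k.+1) * V k =
  U 0 * V 0 - U n * V n - \sum_(0 <= k < n) U k.+1 * (V k - V k.+1).
Proof.
have -> : U 0 * V 0 - U n * V n =
    - \sum_(0 <= k < n) (U k.+1 * V k.+1 - U k * V k).
  by rewrite (telescope_sumr (fun k => U k * V k)) // opprB.
rewrite -sumrN -sumrB; apply: eq_bigr => k _.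
by rewrite mulrBl mulrBr !opprB subrKA.
Qed.

(** On the right the two quadratic terms cancel: each equals [a1 ^+ 2 * a2 ^+ 2 / (r1 * r2) ^+ 2 *
    (r1 * r2) ^+ (2 * k)], because [K] and [L] balance the parameters. The four linear terms left
    are those of the expanded product [Ek]. This is the numerator of $U_k - U_{k+1}$. *)
Lemma Ek_factor (F : fieldType) (a1 a2 a3 a4 r1 r2 r3 r4 : F) (k : nat) :
    a3 != 0 -> a4 != 0 -> r1 != 0 -> r2 != 0 -> r3 != 0 -> r4 != 0 ->
  let K := a1 * a2 * a3 * a4 in
  let L := r1 * r2 * r3 * r4 in
  Ek a1 a2 a3 a4 r1 r2 r3 r4 (k%:Z - 1) / (r3 * r4) ^ (k%:Z - 1) =
  (1 - K * r3 ^+ 2 / (L * a3 ^+ 2) * (L / r3 ^+ 2) ^+ k) *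
  (1 - K * r4 ^+ 2 / (L * a4 ^+ 2) * (L / r4 ^+ 2) ^+ k) -
  (1 - a1 ^+ 2 / r1 ^+ 2 * (r1 ^+ 2) ^+ k) *
  (1 - a2 ^+ 2 / r2 ^+ 2 * (r2 ^+ 2) ^+ k).
Proof.
move=> a3n a4n r1n r2n r3n r4n /=.
(* Every power is reduced to the [k]-th powers of the single roots, with [(r ^+ 2) ^+ k] turned into
   [(r ^+ k) ^+ 2]. Once these are abstracted, [k] is gone and a rational identity remains. *)
rewrite /Ek !exprz_pred ?mulf_neq0 // !exprMn !exprVn -!(exprAC _ k 2).
have := expf_neq0 k r3n; have := expf_neq0 k r4n.
move: (r1 ^+ k) (r2 ^+ k) (r3 ^+ k) (r4 ^+ k) => R1 R2 R3 R4 R4n R3n.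
by field; do ?[apply/andP; split].
Qed.

(** The right side is the last factor of the denominator of $V_{k+1}$ minus that of its numerator,
    hence the numerator of $V_k - V_{k+1}$; the prefactor [x1 / x2] of the second sum is absorbed
    here. *)
Lemma Dk_factor (F : fieldType) (x1 x2 x3 x4 s1 s2 s3 s4 : F) (k : nat) :
    x2 != 0 -> s2 != 0 ->
  x1 / x2 * (Dk x1 x2 x3 x4 s1 s2 s3 s4 k%:Z * (s1 / s2) ^ k%:Z) =
  (1 - x1 * x2 * x3 * x4 / x2 ^+ 2 * (s1 * s2 * s3 * s4 / s2 ^+ 2) ^+ k) -
  (1 - x1 ^+ 2 * (s1 ^+ 2) ^+ k).
Proof.
move=> x2n s2n; rewrite /Dk -!exprnP !exprMn !exprVn -!(exprAC _ k 2).
have := expf_neq0 k s2n.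
move: (s1 ^+ k) (s2 ^+ k) (s3 ^+ k) (s4 ^+ k) => S1 S2 S3 S4 S2n.
by field; do ?[apply/andP; split].
Qed.

Theorem theorem2p2 (R : realType)
    (a1 a2 a3 a4 p1 p2 p3 p4 x1 x2 x3 x4 q1 q2 q3 q4 : R[i])
    (r1 r2 r3 r4 s1 s2 s3 s4 : R[i])
    (ha1 : a1 != 0) (ha2 : a2 != 0) (ha3 : a3 != 0) (ha4 : a4 != 0)
    (hp1 : p1 != 0) (hp2 : p2 != 0) (hp3 : p3 != 0) (hp4 : p4 != 0)
    (hx1 : x1 != 0) (hx2 : x2 != 0) (hx3 : x3 != 0) (hx4 : x4 != 0)
    (hq1 : q1 != 0) (hq2 : q2 != 0) (hq3 : q3 != 0) (hq4 : q4 != 0)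
    (hr1 : r1 ^+ 2 = p1) (hr2 : r2 ^+ 2 = p2)
    (hr3 : r3 ^+ 2 = p3) (hr4 : r4 ^+ 2 = p4)
    (hs1 : s1 ^+ 2 = q1) (hs2 : s2 ^+ 2 = q2)
    (hs3 : s3 ^+ 2 = q3) (hs4 : s4 ^+ 2 = q4)
    (n : nat) :
  let K := a1 * a2 * a3 * a4 in
  let L := r1 * r2 * r3 * r4 in
  let K0 := x1 * x2 * x3 * x4 in
  let L0 := s1 * s2 * s3 * s4 in
  (forall k : nat, (k <= n)%N ->
    [/\ qpoch (K * p3 / (L * a3 ^+ 2)) (L / p3) k != 0,
        qpoch (K * p4 / (L * a4 ^+ 2)) (L / p4) k != 0
      & qpoch (K0 / x2 ^+ 2) (L0 / q2) k != 0]) ->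
  \sum_(0 <= k < n)
     Ek a1 a2 a3 a4 r1 r2 r3 r4 (k%:Z - 1) / (r3 * r4) ^ (k%:Z - 1) *
     ((qpoch (a1 ^+ 2 / p1) p1 k * qpoch (a2 ^+ 2 / p2) p2 k *
       qpoch (x1 ^+ 2) q1 k) /
      (qpoch (K * p3 / (L * a3 ^+ 2)) (L / p3) k.+1 *
       qpoch (K * p4 / (L * a4 ^+ 2)) (L / p4) k.+1 *
       qpoch (K0 / x2 ^+ 2) (L0 / q2) k))
  = 1
    - (qpoch (a1 ^+ 2 / p1) p1 n * qpoch (a2 ^+ 2 / p2) p2 n *
       qpoch (x1 ^+ 2) q1 n) /
      (qpoch (K * p3 / (L * a3 ^+ 2)) (L / p3) n *
       qpoch (K * p4 / (L * a4 ^+ 2)) (L / p4) n *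
       qpoch (K0 / x2 ^+ 2) (L0 / q2) n)
    - x1 / x2 *
      \sum_(0 <= k < n)
        Dk x1 x2 x3 x4 s1 s2 s3 s4 k%:Z * (s1 / s2) ^ k%:Z *
        ((qpoch (a1 ^+ 2 / p1) p1 k.+1 * qpoch (a2 ^+ 2 / p2) p2 k.+1 *
          qpoch (x1 ^+ 2) q1 k) /
         (qpoch (K * p3 / (L * a3 ^+ 2)) (L / p3) k.+1 *
          qpoch (K * p4 / (L * a4 ^+ 2)) (L / p4) k.+1 *
          qpoch (K0 / x2 ^+ 2) (L0 / q2) k.+1)).
Proof.
move=> K L K0 L0 dn.
have sqrt_neq0 (r p : R[i]) : r ^+ 2 = p -> p != 0 -> r != 0.
  by move=> <-; rewrite sqrf_eq0.
have r1n := sqrt_neq0 _ _ hr1 hp1; have r2n := sqrt_neq0 _ _ hr2 hp2.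
have r3n := sqrt_neq0 _ _ hr3 hp3; have r4n := sqrt_neq0 _ _ hr4 hp4.
have s2n := sqrt_neq0 _ _ hs2 hq2.
pose A k := qpoch (a1 ^+ 2 / p1) p1 k; pose B k := qpoch (a2 ^+ 2 / p2) p2 k.
pose C k := qpoch (K * p3 / (L * a3 ^+ 2)) (L / p3) k.
pose D k := qpoch (K * p4 / (L * a4 ^+ 2)) (L / p4) k.
pose X k := qpoch (x1 ^+ 2) q1 k; pose Y k := qpoch (K0 / x2 ^+ 2) (L0 / q2) k.
pose U k := A k * B k / (C k * D k); pose V k := X k / Y k.
have UV k : U k * V k = A k * B k * X k / (C k * D k * Y k).
  by rewrite /U /V mulf_div.
have UV0 : U 0 * V 0 = 1.
  by rewrite UV /A /B /C /D /X /Y !qpoch0 !mulr1 divr1.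
(* The hypothesis at [k.+1 <= n] covers both the product up to [k] and its new last factor. *)
have dS k : (k < n)%N ->
    [/\ C k * (1 - K * p3 / (L * a3 ^+ 2) * (L / p3) ^+ k) != 0,
        D k * (1 - K * p4 / (L * a4 ^+ 2) * (L / p4) ^+ k) != 0 &
        Y k * (1 - K0 / x2 ^+ 2 * (L0 / q2) ^+ k) != 0].
  by move=> /dn[]; rewrite !qpochS.
(* The leading [1] becomes the boundary value at index 0, where all the products are empty. *)
rewrite -/(A n) -/(B n) -/(C n) -/(D n) -/(X n) -/(Y n) -UV -UV0 mulr_sumr.
transitivity (\sum_(0 <= k < n) (U k - U k.+1) * V k); last first.
  rewrite sumr_by_parts; congr (_ - _); apply: eq_big_nat => k /andP[_ kn].
  have [] := dS k kn; rewrite !mulf_eq0 !negb_or.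
  move=> /andP[Cn cn] /andP[Dn dn'] /andP[Yn yn].
  rewrite [RHS]mulrA Dk_factor // hs1 hs2 -/K0 -/L0 /U /V /A /B /C /D /X /Y !qpochS.
  rewrite -/(A k) -/(B k) -/(C k) -/(D k) -/(X k) -/(Y k).
  (* With [a], [b], [c], [d], [x], [y] the new last factors of [A], [B], [C], [D], [X], [Y], the
     identity left is $X/Y - Xx/(Yy) = (y - x)X/(Yy)$, times the common $U_{k+1}$. *)
  move: (1 - _ * (L / p3) ^+ k) (1 - _ * (L / p4) ^+ k) (1 - _ * (L0 / q2) ^+ k)
    cn dn' yn => c d y cn dn' yn.
  move: (1 - _ * p1 ^+ k) (1 - _ * p2 ^+ k) (1 - _ * q1 ^+ k) => a b x.
  move: (A k) (B k) (C k) (D k) (X k) (Y k) Cn Dn Yn => A' B' C' D' X' Y' *.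
  by field; do ?[apply/andP; split].
apply: eq_big_nat => k /andP[_ kn].
have [] := dS k kn; rewrite !mulf_eq0 !negb_or.
move=> /andP[Cn cn] /andP[Dn dn'] /andP[Yn _].
(* Here the factor is $cd - ab$, and the identity is $AB/(CD) - ABab/(CcDd) = (cd - ab)AB/(CcDd)$,
   times $V_k$. *)
rewrite Ek_factor // hr1 hr2 hr3 hr4 -/K -/L /U /V /A /B /C /D /X /Y !qpochS.
rewrite -/(A k) -/(B k) -/(C k) -/(D k) -/(X k) -/(Y k).
move: (1 - _ * (L / p3) ^+ k) (1 - _ * (L / p4) ^+ k) cn dn' => c d cn dn'.
move: (1 - _ * p1 ^+ k) (1 - _ * p2 ^+ k) => a b.
move: (A k) (B k) (C k) (D k) (X k) (Y k) Cn Dn Yn => A' B' C' D' X' Y' *.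
by field; do ?[apply/andP; split].
Qed.
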